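(* Let $a, a^\dagger$ be the annihilation and creation operators of a single boson mode, with $[a,a^\dagger]=1$, acting on the Fock space $\mathcal H$ with number operator $N$, and let $\mathcal D=\bigcap_{k\ge 0}D(N^k)$. For $L\in\mathbb N$ let $Q_L$ be the orthogonal projection onto the span of the number states with at most $L$ bosons, and put $a_L=Q_L a Q_L$, $a_L^\dagger=Q_L a^\dagger Q_L$, $H_L=a_L^\dagger a_L$ (a bounded operator) and, for $t\in\mathbb R$ and $X\in\mathcal L^+(\mathcal D)$, $$\alpha_L^t(X)=e^{iH_Lt}\,X\,e^{-iH_Lt}.$$ Then for every $t\in\mathbb R$ and every natural number $n$, the limits as $L\to\infty$ of $\alpha_L^t(a^n)$ and of $\alpha_L^t((a^\dagger)^n)$ exist in $\mathcal L^+(\mathcal D)[\tau]$, i.e. there are elements of $\mathcal L^+(\mathcal D)$ to which these sequences converge in the topology $\tau$.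
   Context: Fock space: $\Phi_0$ is a unit vector with $a\Phi_0=0$; $\mathcal D_o$ is the linear span of $\{(a^\dagger)^n\Phi_0 : n\in\mathbb N\}$ (with $n=0$ included), and $\mathcal H$ is its Hilbert space completion. $N$ is the unique self-adjoint extension of $a^\dagger a$ on $\mathcal D_o$. $\mathcal E_l$ is the one-dimensional space spanned by $(a^\dagger)^l\Phi_0$, $\Pi_l$ is the orthogonal projection onto $\mathcal E_l$ (so $N=\sum_{l\ge0} l\,\Pi_l$), and $Q_L=\sum_{l=0}^L\Pi_l$. $\mathcal L^+(\mathcal D)$ is the *-algebra of all closable operators $X$ defined on $\mathcal D$ which, together with their adjoints, map $\mathcal D$ into itself (that is, $X\mathcal D\subset\mathcal D$, $\mathcal D\subset D(X^* )$ and $X^*\mathcal D\subset\mathcal D$); the operators $a,a^\dagger$ are regarded as elements of $\mathcal L^+(\mathcal D)$. $\mathcal C$ is the set of all positive, bounded, continuous functions $f$ on $\mathbb R_+=[0,\infty)$ which decrease faster than any inverse power, i.e. $x^kf(x)\to0$ as $x\to\infty$ for all $k\in\mathbb N$. The topology $\tau$ on $\mathcal L^+(\mathcal D)$ is the locally convex topology generated by the seminorms $$\|X\|^{f,k}=\max\{\|f(N)XN^k\|,\ \|N^kXf(N)\|\},\qquad f\in\mathcal C,\ k\in\mathbb N=\{0,1,2,\dots\},$$ where $\|\cdot\|$ on the right is the operator norm of $B(\mathcal H)$ (of the bounded extension from $\mathcal D$); these quantities are finite for $X\in\mathcal L^+(\mathcal D)$. *)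

(* Defs.v *)
From HB Require Import structures.
From mathcomp Require Import all_boot all_order all_algebra.
From mathcomp Require Import sesquilinear complex.
From mathcomp Require Import all_classical all_reals all_analysis.

Set Implicit Arguments.
Unset Strict Implicit.
Unset Printing Implicit Defensive.

Import Order.TTheory GRing.Theory Num.Theory.
Import numFieldNormedType.Exports.

Local Open Scope classical_set_scope.
Local Open Scope ring_scope.
Local Open Scope complex_scope.

(* Unbounded operators on a Hilbert space H are represented by total functions
   H -> H together with a domain D : set H; every notion below only looks at
   the values taken on the domain. *)

Section UnboundedOperators.
Context {R : realType} {H : completeNormedModType R[i]}.

Definition lin_subspace (D : set H) :=
  D 0 /\ forall (c : R[i]) u v, D u -> D v -> D (c *: u + v).

Definition linear_on (D : set H) (X : H -> H) :=
  forall (c : R[i]) u v, D u -> D v -> X (c *: u + v) = c *: X u + X v.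

Definition lin_span (v : nat -> H) : set H :=
  [set u | exists (n : nat) (c : nat -> R[i]), u = \sum_(l < n) c l *: v l].

Fixpoint pow_dom (D : set H) (X : H -> H) (k : nat) : set H :=
  if k is k'.+1 then [set u | D u /\ pow_dom D X k' (X u)] else setT.

Definition smooth_dom (D : set H) (X : H -> H) : set H :=
  \bigcap_(k in setT) pow_dom D X k.

Definition closable_on (D : set H) (X : H -> H) :=
  forall (u_ : nat -> H) (y : H), (forall n, D (u_ n)) ->
    u_ @ \oo --> (0 : H) -> (fun n => X (u_ n)) @ \oo --> y -> y = 0.

(* The inner product is linear in its first argument. *)
Variable ip : {dot H for (@Num.conj R[i])}.

(* (v, w) lies in the graph of the adjoint of (D, X). *)
Definition adj_graph (D : set H) (X : H -> H) (v w : H) :=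
  forall u, D u -> ip (X u) v = ip u w.

Definition selfadjoint (D : set H) (X : H -> H) :=
  [/\ lin_subspace D, dense D, linear_on D X &
      forall v w, adj_graph D X v w <-> D v /\ w = X v].

(* X \in L^+(D). *)
Definition Lplus (D : set H) (X : H -> H) :=
  [/\ linear_on D X, closable_on D X,
      (forall u, D u -> D (X u)) &
      forall v, D v -> exists2 w, D w & adj_graph D X v w].

(* Norm of the bounded extension of X from the dense subspace D (+oo if X is
   unbounded on D). *)
Definition opnorm (D : set H) (X : H -> H) : \bar R :=
  ereal_sup [set (complex.Re `|X u|)%:E | u in [set u | D u /\ `|u| <= 1]].

(* exp(A) u = \sum_k A^k u / k!, for a bounded operator A. *)
Definition opexp (A : H -> H) (u : H) : H :=
  limn (series (fun k : nat => (k`!%:R)^-1 *: iter k A u)).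

End UnboundedOperators.

(* The Fock space of a single boson mode: ann and cre are the operators a and
   a^* on Dinf, the common domain of all powers of the number operator
   (nop_dom, nop). *)
Record fockSpace (R : realType) := FockSpace {
  fock_sp : completeNormedModType R[i];
  fock_ip : {dot fock_sp for (@Num.conj R[i])};
  fock_ipE : forall u, fock_ip u u = `|u| ^+ 2;
  vac : fock_sp;
  ann : fock_sp -> fock_sp;
  cre : fock_sp -> fock_sp;
  nop_dom : set fock_sp;
  nop : fock_sp -> fock_sp;
  (* the unnormalised number state with l bosons *)
  state := fun l : nat => iter l cre vac;
  Do := lin_span state;
  Dinf := smooth_dom nop_dom nop;
  vac_norm : `|vac| = 1;
  ann_vac : ann vac = 0;
  Do_dense : dense Do;
  nop_selfadjoint : selfadjoint fock_ip nop_dom nop;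
  nop_ext : forall u, Do u -> nop_dom u /\ nop u = cre (ann u);
  ann_Lplus : Lplus fock_ip Dinf ann;
  cre_Lplus : Lplus fock_ip Dinf cre;
  cre_adj : forall u v, Dinf u -> Dinf v ->
    fock_ip (ann u) v = fock_ip u (cre v);
  ccr : forall u, Dinf u -> ann (cre u) - cre (ann u) = u
}.

Arguments fock_ip {R} F : rename.
Arguments vac {R} F : rename.
Arguments ann {R} F _ : rename.
Arguments cre {R} F _ : rename.
Arguments nop_dom {R} F _ : rename.
Arguments nop {R} F _ : rename.
Arguments state {R} F _ : rename.
Arguments Do {R} F _ : rename.
Arguments Dinf {R} F _ : rename.

Section Fock.
Context {R : realType}.
Variable F : fockSpace R.
Local Notation H := (fock_sp F).

(* Orthogonal projection onto the line spanned by state l. *)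
Definition Pil (l : nat) (u : H) : H :=
  (fock_ip F u (state F l) / fock_ip F (state F l) (state F l)) *: state F l.

Definition QL (L : nat) (u : H) : H := \sum_(l < L.+1) Pil l u.

Definition annL (L : nat) : H -> H := QL L \o ann F \o QL L.
Definition creL (L : nat) : H -> H := QL L \o cre F \o QL L.
Definition HL (L : nat) : H -> H := creL L \o annL L.

Definition evol (L : nat) (t : R) : H -> H :=
  opexp (fun u => ('i * t%:C) *: HL L u).

Definition alpha (L : nat) (t : R) (X : H -> H) : H -> H :=
  evol L t \o X \o evol L (- t).

(* f(N), from the spectral decomposition N = \sum_l l Pi_l. *)
Definition fnum (f : R -> R) (u : H) : H :=
  limn (series (fun l : nat => (f l%:R)%:C *: Pil l u)).

(* Only the restriction of f to [0, +oo[ is relevant. *)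
Definition rapid (f : R -> R) :=
  [/\ forall x, 0 <= x -> 0 < f x,
      exists M, forall x, 0 <= x -> f x <= M,
      {within [set x : R | 0 <= x], continuous f} &
      forall k : nat, x ^+ k * f x @[x --> +oo] --> (0 : R)].

Definition seminorm (f : R -> R) (k : nat) (X : H -> H) : \bar R :=
  maxe (opnorm (Dinf F) (fnum f \o X \o iter k (nop F)))
       (opnorm (Dinf F) (iter k (nop F) \o X \o fnum f)).

(* Neighbourhoods of X in L^+(D)[tau]. *)
Definition tau_nbhs (X : H -> H) : set_system (H -> H) :=
  [set U | exists (m : nat) (f : 'I_m -> R -> R) (k : 'I_m -> nat) (e : R),
    [/\ 0 < e, forall j, rapid (f j) &
        [set Y | Lplus (fock_ip F) (Dinf F) Y /\
                 forall j, (seminorm (f j) (k j) (Y \- X)%R < e%:E)%E] `<=` U]].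

(* X_ L and X are required to lie in L^+(D). *)
Definition tau_cvg (X_ : nat -> H -> H) (X : H -> H) :=
  [/\ forall L, Lplus (fock_ip F) (Dinf F) (X_ L),
      Lplus (fock_ip F) (Dinf F) X &
      X_ @ \oo `=>` tau_nbhs X].

End Fock.

(* Main.v *)
(** In the orthonormal basis [e l] of normalised number states, [HL L] acts as
    multiplication by [l] for [l <= L] and by [0] for [l > L], so [evol L t] is
    diagonal with unimodular entries.  Hence [alpha L t (a^n)] is a weighted shift
    whose weights agree with those of [exp(-int) a^n] as soon as all the number
    states involved have at most [L] bosons, and otherwise differ from them by at
    most [2 (l+n+1)^n].  Inside the seminorms [f(N) _ N^k] and [N^k _ f(N)] the
    remaining weights are damped by the rapidly decreasing [f], so that their
    supremum, which bounds the operator norm, tends to [0].  Creation operators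
    are treated in the same way, with limit [exp(int) (a^dagger)^n].  Domain
    questions are reduced to coefficients: by self-adjointness of [nop], [Dinf]
    consists of the vectors with rapidly decreasing coefficients. *)

Require Import Defs.
From mathcomp Require Import all_boot all_order all_algebra.
From mathcomp Require Import sesquilinear complex.
From mathcomp Require Import all_classical all_reals all_analysis.
From mathcomp Require Import ring zify.

Set Implicit Arguments.
Unset Strict Implicit.
Unset Printing Implicit Defensive.

Import Order.TTheory GRing.Theory Num.Theory.
Import numFieldNormedType.Exports.

Local Open Scope classical_set_scope.
Local Open Scope ring_scope.

Lemma archi_complex (R : realType) (z : complex R) : 0 <= z ->
  exists k : nat, z < k.+1%:R.
Proof.
move=> /ger0_real/RRe_real <-; exists (Num.truncn (complex.Re z)).
by rewrite -(rmorph_nat (real_complex R)) ltcR truncnS_gt.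
Qed.

(** * Cauchy-Schwarz and passage to the limit in inner products *)

Section InnerProduct.
Context {R : realType} {H : completeNormedModType (complex R)}.
Local Notation C := (complex R).
Variable ip : {dot H for (@Num.conj C)}.
Hypothesis ipE : forall u, ip u u = `|u| ^+ 2.

Lemma ipDl u v w : ip (u + v) w = ip u w + ip v w.
Proof. exact: linearDl. Qed.

Lemma ipZl a u w : ip (a *: u) w = a * ip u w.
Proof. exact: linearZl_LR. Qed.

Lemma ipBl u v w : ip (u - v) w = ip u w - ip v w.
Proof. exact: linearBl. Qed.

Lemma ip0l w : ip 0 w = 0.
Proof. exact: linear0l. Qed.

Lemma ipDr u v w : ip w (u + v) = ip w u + ip w v.
Proof. exact: linearDr. Qed.

Lemma ipZr a u w : ip w (a *: u) = Num.conj a * ip w u.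
Proof. exact: linearZr_LR. Qed.

Lemma ip0r w : ip w 0 = 0.
Proof. exact: linear0r. Qed.

Lemma ip_suml (I : Type) (r : seq I) (P : pred I) (G : I -> H) w :
  ip (\sum_(i <- r | P i) G i) w = \sum_(i <- r | P i) ip (G i) w.
Proof. exact: linear_sumlz. Qed.

Lemma ip_sumr (I : Type) (r : seq I) (P : pred I) (G : I -> H) w :
  ip w (\sum_(i <- r | P i) G i) = \sum_(i <- r | P i) ip w (G i).
Proof. exact: linear_sumr. Qed.

Lemma ipC u v : ip u v = Num.conj (ip v u).
Proof. by rewrite (hermC ip) expr0 mul1r. Qed.

Lemma pythagoras u v : ip u v = 0 -> `|u + v| ^+ 2 = `|u| ^+ 2 + `|v| ^+ 2.
Proof. by move=> uv; rewrite -!ipE (hnormDd uv). Qed.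

Lemma cauchy_schwarz u v : `|ip u v| <= `|u| * `|v|.
Proof.
have [->|v0] := eqVneq v 0; first by rewrite ip0r !normr0 mulr0.
have vv : 0 < `|v| ^+ 2 by rewrite exprn_gt0// normr_gt0.
pose a := ip u v / `|v| ^+ 2.
have ort : ip (u - a *: v) (a *: v) = 0.
  by rewrite ipZr ipBl ipZl ipE /a divfK ?gt_eqF// subrr mulr0.
rewrite -(@ler_pXn2r _ 2) ?nnegrE ?mulr_ge0// [leRHS]exprMn.
have -> : `|u| ^+ 2 = `|u - a *: v| ^+ 2 + (`|a| * `|v|) ^+ 2.
  by rewrite -normrZ -(pythagoras ort) subrK.
rewrite mulrDl -[leLHS]add0r lerD ?mulr_ge0 ?exprn_ge0//.
have -> : `|ip u v| = `|a| * `|v| * `|v|.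
  rewrite -mulrA -expr2 -[in X in _ * X](@ger0_norm _ (`|v| ^+ 2)) ?exprn_ge0//.
  by rewrite -normrM /a divfK ?gt_eqF.
by rewrite exprMn.
Qed.

Lemma eq0_normr_le (z : C) : (forall e, 0 < e -> `|z| <= e) -> z = 0.
Proof.
move=> ze; apply/eqP/negPn/negP => z0.
have z0' : 0 < `|z| by rewrite normr_gt0.
have := ze (`|z| / 2) (divr_gt0 z0' (ltr0n _ 2)).
by rewrite ler_pdivlMr// mulr_natr mulr2n gerDl normr_le0 (negbTE z0).
Qed.

(** Continuity of the inner product, from Cauchy-Schwarz; two sequences are treated at once so that
    an adjoint relation can pass to the limit on both sides. *)
Lemma cvg_ip_eq (u_ v_ : nat -> H) u v x y :
  u_ @ \oo --> u -> v_ @ \oo --> v ->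
  (\forall n \near \oo, ip (u_ n) x = ip (v_ n) y) -> ip u x = ip v y.
Proof.
move=> /cvgrPdist_lt uu /cvgrPdist_lt vv uv; apply: subr0_eq; apply: eq0_normr_le => e e0.
pose M := `|x| + `|y| + 1.
have M0 : 0 < M by rewrite ltr_wpDl// addr_ge0.
(* The [1] in [M] keeps it positive when [x] and [y] both vanish. *)
have [n [un vn uvn]] : exists n, [/\ `|u - u_ n| < e / M, `|v - v_ n| < e / M &
    ip (u_ n) x = ip (v_ n) y].
  have eM : 0 < e / M by rewrite divr_gt0.
  near \oo => n; exists n; split; near: n; [exact: uu|exact: vv|exact: uv].
have -> : ip u x - ip v y = ip (u - u_ n) x - ip (v - v_ n) y.
  by rewrite !ipBl uvn; ring.
apply: (le_trans (ler_normB _ _)).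
apply: (le_trans (lerD (cauchy_schwarz _ _) (cauchy_schwarz _ _))).
apply: (@le_trans _ _ (e / M * `|x| + e / M * `|y|)).
  by rewrite lerD// ler_wpM2r// ltW.
by rewrite -mulrDr mulrAC ler_pdivrMr// ler_pM2l// lerDl.
Unshelve. all: by end_near. Qed.

End InnerProduct.

(** * Orthonormal expansions: Bessel, completeness, weighted shifts *)

Section OrthonormalBasis.
Context {R : realType} {H : completeNormedModType (complex R)}.
Local Notation C := (complex R).
Variable ip : {dot H for (@Num.conj C)}.
Hypothesis ipE : forall u, ip u u = `|u| ^+ 2.
Variable e : nat -> H.
Hypothesis e_orth : forall l m, ip (e l) (e m) = (l == m)%:R.

Local Notation c u l := (ip u (e l)).
Local Notation P n u := (\sum_(l < n) ip u (e l) *: e l).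

Lemma coef_sum (d : nat -> C) n m :
  ip (\sum_(l < n) d l *: e l) (e m) = if (m < n)%N then d m else 0.
Proof.
rewrite ip_suml; case: ltnP => mn.
  rewrite (bigD1 (Ordinal mn))//= ipZl e_orth eqxx mulr1 big1 ?addr0// => i im.
  rewrite ipZl e_orth; have /negbTE -> : (i : nat) != m by [].
  by rewrite mulr0.
rewrite big1// => i _; rewrite ipZl e_orth ltn_eqF ?mulr0//.
exact: leq_trans (ltn_ord i) mn.
Qed.

Lemma normr_sum_orth (d : nat -> C) n :
  `|\sum_(l < n) d l *: e l| ^+ 2 = \sum_(l < n) `|d l| ^+ 2.
Proof.
rewrite -ipE ip_sumr; apply: eq_bigr => i _.
by rewrite ipZr coef_sum ltn_ord mulrC -normCK.
Qed.

Lemma proj_orth u (d : nat -> C) n : ip (u - P n u) (\sum_(l < n) d l *: e l) = 0.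
Proof.
rewrite ip_sumr big1// => i _.
by rewrite ipZr ipBl (coef_sum (fun l => c u l)) ltn_ord subrr mulr0.
Qed.

Lemma bessel u n : \sum_(l < n) `|c u l| ^+ 2 <= `|u| ^+ 2.
Proof.
rewrite -(normr_sum_orth (fun l => c u l)) -{2}[u](subrK (P n u)).
by rewrite (pythagoras ipE (proj_orth u (fun l => c u l) n)) lerDr exprn_ge0.
Qed.

Lemma bessel1 u l : `|c u l| <= `|u|.
Proof.
rewrite -(@ler_pXn2r _ 2) ?nnegrE//; apply: le_trans (bessel u l.+1).
by rewrite big_ord_recr/= lerDr sumr_ge0// => i _; rewrite exprn_ge0.
Qed.

(* Norm convergence, because [1 / ((l+1)(l+2))] telescopes. *)
Lemma cvg_sum_orth (d : nat -> C) (K : C) : 0 <= K ->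
  (forall l, `|d l| <= K / (l.+1%:R * l.+2%:R)) ->
  exists2 u, series (fun l => d l *: e l) @ \oo --> u & forall l, c u l = d l.
Proof.
move=> K0 dK.
pose s := series (fun l => d l *: e l).
have norm_e l : `|e l| = 1.
  by apply/eqP; rewrite -(@eqrXn2 _ 2)// -ipE e_orth eqxx expr1n.
have tel (j : nat) : K / j.+1%:R - K / j.+2%:R = K / (j.+1%:R * j.+2%:R).
  have x0 : (j.+1%:R : C) != 0 by rewrite pnatr_eq0.
  have : (j.+2%:R : C) != 0 by rewrite pnatr_eq0.
  rewrite -[j.+2%:R]natr1; move: (_%:R) x0 => x x0 x1; field.
  by rewrite x0 x1.
have tail n k : `|s (n + k)%N - s n| <= K / n.+1%:R - K / (n + k).+1%:R.
  elim: k => [|k IH]; first by rewrite addn0 !subrr normr0.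
  rewrite addnS /s seriesSr/= -/s addrC addrA [- _ + _]addrC.
  apply: (le_trans (ler_normD _ _)).
  have -> : K / n.+1%:R - K / (n + k).+2%:R =
    (K / n.+1%:R - K / (n + k).+1%:R) + K / ((n + k).+1%:R * (n + k).+2%:R).
    by rewrite -tel addrA subrK.
  by rewrite lerD// normrZ norm_e mulr1.
have : cvg (s @ \oo).
  apply/cauchy_cvgP/cauchy_exP => eps eps0.
  have [k Kk] := archi_complex (divr_ge0 K0 (ltW eps0)); exists (s k).
  exists k => // m /= km; rewrite -ball_normE /ball_/= distrC.
  rewrite -(subnKC km); apply: le_lt_trans (tail _ _) _.
  apply: (@le_lt_trans _ _ (K / k.+1%:R)); first by rewrite gerBl divr_ge0.
  by rewrite ltr_pdivrMr// -ltr_pdivrMl// mulrC.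
move=> /cvg_ex[u su]; exists u => // l.
have <- : ip (d l *: e l) (e l) = d l by rewrite ipZl e_orth eqxx mulr1.
apply: (cvg_ip_eq ipE su (cvg_cst _)).
near=> n.
rewrite /s /series/= big_mkord coef_sum ifT; last by near: n; exact: nbhs_infty_gt.
by rewrite ipZl e_orth eqxx mulr1.
Unshelve. all: by end_near. Qed.

Hypothesis e_dense : dense (lin_span e).

(** Projections are best approximations: density gives [w] in the span near [u], and once [n]
    reaches the length of [w] the projection is at least as close to [u]. *)
Lemma proj_cvg u : (fun n => P n u) @ \oo --> u.
Proof.
apply/cvgrPdist_lt => eps eps0.
have [w [/= uw [n0 [d wE]]]] : (ball_ Num.Def.normr u eps `&` lin_span e) !=set0.
  apply: e_dense; first by exists u; rewrite /ball_/= subrr normr0.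
  by rewrite ball_normE; exact: ball_open.
near=> n; apply: le_lt_trans uw.
rewrite -(@ler_pXn2r _ 2) ?nnegrE//.
pose d' l := c u l - (if (l < n0)%N then d l else 0).
have -> : u - w = (u - P n u) + \sum_(l < n) d' l *: e l.
  have n0n : (n0 <= n)%N by near: n; exact: nbhs_infty_ge.
  rewrite -addrA; congr (_ + _); rewrite -sumrN -big_split/= wE.
  rewrite (big_ord_widen _ (fun l => d l *: e l) n0n) big_mkcond -sumrN.
  apply: eq_bigr => l _; rewrite /d' scalerBl addKr.
  by case: ifP => _; rewrite ?scale0r.
by rewrite (pythagoras ipE (proj_orth u d' n)) lerDl exprn_ge0.
Unshelve. all: by end_near. Qed.

(** If the norm exceeded [K], the projections, of norm at most [K], could not converge to [u]. *)
Lemma norm_le_coef u (K : C) : 0 <= K ->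
  (forall n, \sum_(l < n) `|c u l| ^+ 2 <= K ^+ 2) -> `|u| <= K.
Proof.
move=> K0 uK; rewrite real_leNgt ?ger0_real//; apply/negP => Ku.
have eps0 : 0 < `|u| - K by rewrite subr_gt0.
have /cvgrPdist_lt pu := @proj_cvg u.
have [n _ /(_ n (leqnn n))/=] := pu _ eps0.
suff /le_gtF -> : `|u| - K <= `|u - P n u| by [].
rewrite lerBlDr.
rewrite -{1}[u](subrK (P n u)); apply: (le_trans (ler_normD _ _)); rewrite lerD2l.
by rewrite -(@ler_pXn2r _ 2) ?nnegrE// (normr_sum_orth (fun l => c u l)).
Qed.

(** Bounds a weighted left shift by the supremum of its weights: Bessel's inequality for [u], with
    its first [m] terms dropped. *)
Lemma norm_le_shiftl u v m (B : C) : 0 <= B ->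
  (forall l, `|c v l| <= B * `|c u (l + m)%N|) -> `|v| <= B * `|u|.
Proof.
move=> B0 vu; apply: norm_le_coef => [|n]; first by rewrite mulr_ge0.
rewrite exprMn; apply: le_trans (ler_wpM2l (exprn_ge0 2 B0) (bessel u (m + n))).
rewrite big_split_ord/= mulrDr -[leLHS]add0r lerD//.
  by rewrite mulr_ge0 ?exprn_ge0// sumr_ge0// => i _; rewrite exprn_ge0.
rewrite mulr_sumr ler_sum// => l _; rewrite -exprMn.
by rewrite ler_pXn2r ?nnegrE ?mulr_ge0// addnC.
Qed.

(** Right-shift counterpart: the first [m] coefficients of [v] receive nothing from [u]. *)
Lemma norm_le_shiftr u v m (B : C) : 0 <= B ->
  (forall l, (l < m)%N -> c v l = 0) ->
  (forall l, `|c v (l + m)%N| <= B * `|c u l|) -> `|v| <= B * `|u|.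
Proof.
move=> B0 v0 vu; apply: norm_le_coef => [|n]; first by rewrite mulr_ge0.
rewrite exprMn; apply: le_trans (ler_wpM2l (exprn_ge0 2 B0) (bessel u n)).
apply: (@le_trans _ _ (\sum_(l < m + n) `|c v l| ^+ 2)).
  rewrite addnC big_split_ord/= lerDl sumr_ge0// => i _; exact: exprn_ge0.
rewrite big_split_ord/= big1 ?add0r => [|i _]; last by rewrite v0// normr0 expr0n.
rewrite mulr_sumr ler_sum// => l _; rewrite -exprMn.
by rewrite ler_pXn2r ?nnegrE ?mulr_ge0// addnC.
Qed.

Lemma coef_inj u v : (forall l, c u l = c v l) -> u = v.
Proof.
move=> uv; apply: subr0_eq; apply/eqP; rewrite -normr_eq0; apply/eqP/le_anti.
rewrite normr_ge0 andbT; apply: norm_le_coef => // n.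
rewrite big1 ?sqrr_ge0// => l _.
by rewrite ipBl uv subrr normr0 expr0n.
Qed.

End OrthonormalBasis.

(** * Linear maps on a subspace *)

Section LinearOn.
Context {R : realType} {H : completeNormedModType (complex R)}.
Variables (D : set H) (X : H -> H).
Hypotheses (D_lin : lin_subspace D) (X_lin : linear_on D X).

Lemma lin_subspaceD u v : D u -> D v -> D (u + v).
Proof. by move=> Du Dv; rewrite -[u]scale1r; apply: D_lin.2. Qed.

Lemma lin_subspaceZ a u : D u -> D (a *: u).
Proof. by move=> Du; rewrite -[_ *: _]addr0; apply: D_lin.2 => //; exact: D_lin.1. Qed.

Lemma lin_subspaceB u v : D u -> D v -> D (u - v).
Proof.
by move=> Du Dv; apply: lin_subspaceD => //; rewrite -scaleN1r; exact: lin_subspaceZ.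
Qed.

Lemma lin_subspace_sum n (G : nat -> H) :
  (forall l, D (G l)) -> D (\sum_(l < n) G l).
Proof.
move=> DG; elim: n => [|n IH]; first by rewrite big_ord0; exact: D_lin.1.
by rewrite big_ord_recr/=; exact: lin_subspaceD.
Qed.

Lemma linear_onD u v : D u -> D v -> X (u + v) = X u + X v.
Proof. by move=> Du Dv; have := X_lin 1 Du Dv; rewrite !scale1r. Qed.

Lemma linear_on0 : X 0 = 0.
Proof.
have D0 := D_lin.1.
have := linear_onD D0 D0; rewrite addr0 => /eqP.
by rewrite -subr_eq0 opprD addNKr oppr_eq0 => /eqP.
Qed.

Lemma linear_onZ a u : D u -> X (a *: u) = a *: X u.
Proof.
by move=> Du; rewrite -[a *: u]addr0 (X_lin _ Du D_lin.1) linear_on0 addr0.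
Qed.

End LinearOn.

(** * Number states and coefficients in Fock space *)

Section FockBasis.
Context {R : realType} (F : fockSpace R).
Local Notation C := (complex R).
Local Notation H := (fock_sp F).
Local Notation ip := (fock_ip F).
Local Notation D := (Dinf F).

Lemma nop_dom_lin : lin_subspace (nop_dom F).
Proof. by case: (nop_selfadjoint F). Qed.

Lemma nop_lin : linear_on (nop_dom F) (nop F).
Proof. by case: (nop_selfadjoint F). Qed.

Lemma Dinf_lin : lin_subspace D.
Proof.
split=> [k _|a u v Du Dv k _].
  elim: k => // k IH; split; first exact: nop_dom_lin.1.
  by rewrite (linear_on0 nop_dom_lin nop_lin).
elim: k u v {Du Dv}(Du k I) (Dv k I) => // k IH u v [Du Nu] [Dv Nv].
by split; [exact: nop_dom_lin.2|rewrite nop_lin//; exact: IH].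
Qed.

Lemma Dinf_nop_dom u : D u -> nop_dom F u.
Proof. by move=> /(_ 1%N I)[]. Qed.

Lemma Dinf_nop u : D u -> D (nop F u).
Proof. by move=> Du k _; case: (Du k.+1 I). Qed.

Lemma Dinf_iter_nop k u : D u -> D (iter k (nop F) u).
Proof. by move=> Du; elim: k => //= k; exact: Dinf_nop. Qed.

Lemma nop_sym u v : nop_dom F u -> nop_dom F v -> ip (nop F u) v = ip u (nop F v).
Proof.
case: (nop_selfadjoint F) => _ _ _ sa Du Dv.
by have [_ /(_ (conj Dv erefl))/(_ _ Du)] := sa v (nop F v).
Qed.

Lemma Dinf_cre u : D u -> D (cre F u).
Proof. by case: (cre_Lplus F) => _ _ + _; apply. Qed.

Lemma ann_lin : linear_on D (ann F).
Proof. by case: (ann_Lplus F). Qed.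

Lemma cre_lin : linear_on D (cre F).
Proof. by case: (cre_Lplus F). Qed.

Lemma state_Do l : Do F (state F l).
Proof.
exists l.+1, (fun m => (m == l)%:R); rewrite (bigD1 ord_max)//= eqxx scale1r.
rewrite big1 ?addr0// => i il; have /negbTE -> : (i : nat) != l by [].
by rewrite scale0r.
Qed.

(** [cre] preserves [Dinf], so only the vacuum is checked, which [nop] sends to [0]. *)
Lemma Dinf_state l : D (state F l).
Proof.
elim: l => [|l IH]; last exact: Dinf_cre.
move=> k _; elim: k => // k IH; have [dv nv] := nop_ext (state_Do 0).
split => //; rewrite nv [state F 0]/= ann_vac (linear_on0 Dinf_lin cre_lin).
by have := Dinf_lin.1; apply.
Qed.

(** [ccr] moves [ann] past one [cre] at a time, each exchange adding [1] to the factor. *)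
Lemma ann_state l : ann F (state F l.+1) = l.+1%:R *: state F l.
Proof.
elim: l => [|l IH].
  have := ccr (Dinf_state 0); rewrite [state F 0]/= ann_vac.
  by rewrite (linear_on0 Dinf_lin cre_lin) subr0 scale1r.
have /eqP := ccr (Dinf_state l.+1); rewrite subr_eq => /eqP.
rewrite IH (linear_onZ Dinf_lin cre_lin)//; last exact: Dinf_state.
by rewrite -[l.+2%:R]nat1r scalerDl scale1r.
Qed.

(** Moving a [cre] across as [ann] lowers both indices and yields one factor of the factorial; at
    index [0] the vacuum is annihilated. *)
Lemma ip_state l m : ip (state F l) (state F m) = (l == m)%:R * l`!%:R.
Proof.
elim: l m => [|l IH] [|m].
- by rewrite fock_ipE vac_norm expr1n fact0 mulr1.
- rewrite /= -cre_adj; [|exact: (Dinf_state 0)|exact: Dinf_state].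
  by rewrite ann_vac ip0l mul0r.
- rewrite ipC /= -cre_adj; [|exact: (Dinf_state 0)|exact: Dinf_state].
  by rewrite ann_vac ip0l rmorph0 mul0r.
- rewrite [state F m.+1]/= -cre_adj; [|exact: Dinf_state..].
  by rewrite ann_state ipZl IH factS natrM eqSS mulrCA.
Qed.

(* Locked so that rewriting with [ipZl] and [ipZr] does not see through it. *)
Definition num_state : nat -> H :=
  locked (fun l => (sqrtC (l`!%:R : C))^-1 *: state F l).

Lemma num_stateE l : num_state l = (sqrtC (l`!%:R : C))^-1 *: state F l.
Proof. by rewrite /num_state -lock. Qed.

Local Notation e := num_state.
Local Notation c u l := (ip u (num_state l)).

Lemma sqrt_fact_neq0 l : sqrtC (l`!%:R : C) != 0.
Proof. by rewrite sqrtC_eq0 pnatr_eq0 -lt0n fact_gt0. Qed.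

Lemma state_num_state l : state F l = sqrtC (l`!%:R) *: e l.
Proof. by rewrite num_stateE scalerA divff ?scale1r// sqrt_fact_neq0. Qed.

Lemma num_state_orth l m : ip (e l) (e m) = (l == m)%:R.
Proof.
rewrite !num_stateE ipZl ipZr ip_state.
have [->|_] := eqVneq l m; last by rewrite mul0r !mulr0.
rewrite mul1r geC0_conj; last by rewrite invr_ge0 sqrtC_ge0 ler0n.
by rewrite mulrA -invfM -expr2 sqrtCK mulVf// pnatr_eq0 -lt0n fact_gt0.
Qed.

Lemma Dinf_num_state l : D (e l).
Proof. by rewrite num_stateE; apply: (lin_subspaceZ Dinf_lin); exact: Dinf_state. Qed.

Lemma Dinf_num_sum (d : nat -> C) n : D (\sum_(l < n) d l *: e l).
Proof.
apply: (@lin_subspace_sum _ _ _ Dinf_lin n (fun l => d l *: e l)) => l.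
by apply: (lin_subspaceZ Dinf_lin); exact: Dinf_num_state.
Qed.

Lemma num_state_dense : dense (lin_span e).
Proof.
move=> O On Oo; have [w [Ow [n [d wE]]]] := Do_dense On Oo.
exists w; split => //; exists n, (fun l => d l * sqrtC l`!%:R).
by rewrite wE; apply: eq_bigr => l _; rewrite state_num_state scalerA.
Qed.

Lemma cre_num_state l : cre F (e l) = sqrtC l.+1%:R *: e l.+1.
Proof.
rewrite !num_stateE (linear_onZ Dinf_lin cre_lin) ?scalerA; last exact: Dinf_state.
rewrite factS natrM sqrtCM ?nnegrE// invfM mulrA divff ?mul1r//.
by rewrite sqrtC_eq0 pnatr_eq0.
Qed.

Lemma ann_num_state l : ann F (e l.+1) = sqrtC l.+1%:R *: e l.
Proof.
rewrite !num_stateE (linear_onZ Dinf_lin ann_lin); last exact: Dinf_state.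
rewrite ann_state !scalerA; congr (_ *: _).
rewrite factS natrM sqrtCM ?nnegrE// invfM mulrAC -{2}[l.+1%:R]sqrtCK expr2 mulrA.
by rewrite mulVf ?mul1r// sqrtC_eq0 pnatr_eq0.
Qed.

Lemma ann_num_state0 : ann F (e 0) = 0.
Proof.
rewrite !num_stateE (linear_onZ Dinf_lin ann_lin); last exact: (Dinf_state 0).
by rewrite ann_vac scaler0.
Qed.

Lemma nop_num_state l : nop F (e l) = l%:R *: e l.
Proof.
rewrite !num_stateE (linear_onZ nop_dom_lin nop_lin); last exact: Dinf_nop_dom (Dinf_state l).
have -> : nop F (state F l) = l%:R *: state F l.
  rewrite (nop_ext (state_Do l)).2; case: l => [|l].
    by rewrite ann_vac (linear_on0 Dinf_lin cre_lin) scale0r.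
  by rewrite ann_state (linear_onZ Dinf_lin cre_lin)//; exact: Dinf_state.
by rewrite !scalerA mulrC.
Qed.

Lemma sqrtC_nat_conj n : Num.conj (sqrtC (n%:R : C)) = sqrtC n%:R.
Proof. by rewrite geC0_conj// sqrtC_ge0. Qed.

(** Adjointness moves the operator onto the number state, so it never has to be applied to an
    infinite expansion; the same device serves for [cre] and [nop]. *)
Lemma coef_ann u l : D u -> c (ann F u) l = sqrtC l.+1%:R * c u l.+1.
Proof.
move=> Du; rewrite cre_adj//; last exact: Dinf_num_state.
by rewrite cre_num_state ipZr sqrtC_nat_conj.
Qed.

Lemma coef_cre u l : D u -> c (cre F u) l.+1 = sqrtC l.+1%:R * c u l.
Proof.
move=> Du; rewrite ipC -cre_adj//; last exact: Dinf_num_state.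
by rewrite ann_num_state ipZl rmorphM/= sqrtC_nat_conj -ipC.
Qed.

Lemma coef_cre0 u : D u -> c (cre F u) 0 = 0.
Proof.
move=> Du; rewrite ipC -cre_adj//; last exact: Dinf_num_state.
by rewrite ann_num_state0 ip0l rmorph0.
Qed.

Lemma coef_nop u l : nop_dom F u -> c (nop F u) l = l%:R * c u l.
Proof.
move=> Du; rewrite nop_sym//; last exact: Dinf_nop_dom (Dinf_num_state l).
by rewrite nop_num_state ipZr rmorph_nat.
Qed.

Lemma coef_iter_nop k u l : D u -> c (iter k (nop F) u) l = l%:R ^+ k * c u l.
Proof.
move=> Du; elim: k => [|k IH]; first by rewrite mul1r.
rewrite /= coef_nop ?IH ?exprS ?mulrA//; exact: Dinf_nop_dom (Dinf_iter_nop k Du).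
Qed.

End FockBasis.

(** * Unimodular phases and their exponential series *)

Section Phase.
Context {R : realType}.
Local Notation C := (complex R).
Implicit Types x y : R.

(** This is exp(ix). *)
Definition phase x : C := Complex (cos x) (sin x).

Lemma phase0 : phase 0 = 1.
Proof. by rewrite /phase cos0 sin0. Qed.

Lemma phaseD x y : phase (x + y) = phase x * phase y.
Proof.
rewrite /phase cosD sinD; apply/eqP.
by rewrite eq_complex/= addrC [sin x * _ + _]addrC !eqxx.
Qed.

Lemma normr_phase x : `|phase x| = 1.
Proof. by rewrite normc_def/= cos2Dsin2 sqrtr1. Qed.

Lemma conj_phase x : Num.conj (phase x) = phase (- x).
Proof.
have ux : phase x \is a GRing.unit by rewrite unitfE -normr_gt0 normr_phase.
apply: (mulrI ux).
by rewrite -phaseD subrr phase0 -normCK normr_phase expr1n.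
Qed.

(** Even powers of [i] are real and odd ones imaginary, so the exponential series splits into the
    cosine and sine series. *)
Lemma phase_coeff x k :
  (k`!%:R : C)^-1 * ('i * (real_complex R x)) ^+ k =
  Complex (cos_coeff x k) (sin_coeff x k).
Proof.
have i2 : (Complex 0 1 : C) ^+ 2 = -1 by exact: sqr_i.
have fE : (k`!%:R : C)^-1 = real_complex R (k`!%:R)^-1.
  by rewrite fmorphV rmorph_nat.
have -> : ('i : C) = Complex 0 1 by [].
have iE j : (Complex 0 1 : C) ^+ j.*2 = real_complex R ((-1) ^+ j).
  by rewrite -mul2n exprM i2 rmorphXn/= rmorphN1.
rewrite /cos_coeff /sin_coeff/= fE exprMn -rmorphXn/=.
have := odd_double_half k; move: k./2 => j {fE}; case: (odd k) => /= <-.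
  rewrite add1n exprS iE mulrCA -!rmorphM/= doubleK -exprnP.
  by simpc; congr Complex; ring.
rewrite add0n iE -!rmorphM/= -exprnP.
by simpc; congr Complex; rewrite ?mul0r//; ring.
Qed.

Lemma phase_cvg x (e : C) : 0 < e ->
  \forall n \near \oo,
    `|phase x - \sum_(k < n) (k`!%:R)^-1 * ('i * (real_complex R x)) ^+ k| < e.
Proof.
move=> e0.
(* A positive complex number is real, so the real cosine and sine series can be used, each with
   error [r / 2]. *)
have [r r0 ->] : exists2 r : R, 0 < r & e = real_complex R r.
  exists (complex.Re e); last by rewrite RRe_real ?gtr0_real.
  by rewrite -ltcR RRe_real ?gtr0_real.
have cc : series (cos_coeff x) @ \oo --> cos x.
  by rewrite unlock; exact: is_cvg_series_cos_coeff.
have ss : series (sin_coeff x) @ \oo --> sin x.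
  by rewrite unlock; exact: is_cvg_series_sin_coeff.
have r2 : 0 < r / 2 by rewrite divr_gt0.
move/cvgrPdist_lt : cc => /(_ _ r2) cc; move/cvgrPdist_lt : ss => /(_ _ r2) ss.
have sE n : \sum_(k < n) (k`!%:R)^-1 * ('i * (real_complex R x)) ^+ k =
    Complex (series (cos_coeff x) n) (series (sin_coeff x) n).
  rewrite /series/= !big_mkord; elim: n => [|n IH]; first by rewrite !big_ord0.
  by rewrite !big_ord_recr/= IH phase_coeff.
near=> n; rewrite sE.
have an : `|cos x - series (cos_coeff x) n| < r / 2 by near: n.
have bn : `|sin x - series (sin_coeff x) n| < r / 2 by near: n.
move: an bn; set a := series _ n; set b := series _ n.
have -> : phase x - Complex a b =
    real_complex R (cos x - a) + 'i * real_complex R (sin x - b).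
  by rewrite [LHS]complexE.
move=> an bn; apply: (le_lt_trans (ler_normD _ _)).
have nR (y : R) : `|real_complex R y| = real_complex R `|y|.
  by rewrite normc_def/= expr0n addr0 sqrtr_sqr.
by rewrite normrM normCi mul1r !nR -rmorphD/= ltcR [r]splitr ltrD.
Unshelve. all: by end_near. Qed.

End Phase.

(** * Bounds for rapidly decreasing functions at the integers *)

Lemma rapid_tail (R : realType) (f : R -> R) (j n : nat) (eps : R) :
  rapid f -> 0 < eps ->
  exists N, forall l, (N <= l)%N -> f l%:R * (l + n).+1%:R ^+ j < eps.
Proof.
move=> [f0 _ _ fd] eps0.
(* This factor pays for replacing [l] by [l + n + 1], which is at most [(n + 2) * l] for positive
   [l]; the successor in the threshold below ensures positivity. *)
have n20 : 0 < n.+2%:R ^+ j :> R by rewrite exprn_gt0.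
have := fd j => /cvgrPdist_lt/(_ _ (divr_gt0 eps0 n20))[A [_ fA]].
exists (Num.truncn `|A|).+1 => l Al.
have l0 : (0 < l)%N by rewrite (leq_trans _ Al).
have /fA : A < l%:R.
  apply: le_lt_trans (ler_norm _) _; apply: lt_le_trans (truncnS_gt _) _.
  by rewrite ler_nat.
rewrite sub0r normrN ger0_norm ?mulr_ge0 ?exprn_ge0 ?(ltW (f0 _ _))// ltr_pdivlMr//.
apply: le_lt_trans; rewrite mulrC -mulrA [_ * n.+2%:R ^+ j]mulrC mulrA -exprMn.
rewrite ler_wpM2r ?(ltW (f0 _ _))// lerXn2r ?nnegrE ?mulr_ge0//.
by rewrite -natrM ler_nat; nia.
Qed.

(** Gives the telescoping bound under which [cvg_sum_orth] makes the series for [f(N)] converge. *)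
Lemma rapid_summable (R : realType) (f : R -> R) : rapid f ->
  exists2 K, 0 <= K & forall l : nat, f l%:R <= K / (l.+1%:R * l.+2%:R).
Proof.
move=> rf; have [N fN] := rapid_tail 2 1 rf ltr01.
case: rf => f0 [M fM] _ _.
have M0 : 0 <= M by apply: le_trans (fM 0 _) => //; exact/ltW/f0.
(* The [1] covers the tail from [N] on, where [f] times the square of [l + 2] is below one; the
   other term covers [l < N] through the bound [M]. *)
exists (1 + M * (N.+1%:R * N.+2%:R)) => [|l].
  by rewrite addr_ge0// !mulr_ge0.
rewrite ler_pdivlMr ?mulr_gt0//; have [lN|Nl] := ltnP l N.
  rewrite ler_wpDl// ler_pM ?mulr_ge0// ?(ltW (f0 _ _)) ?fM//.
  by rewrite ler_pM// ler_nat; lia.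
apply: (@le_trans _ _ 1); last by rewrite lerDl !mulr_ge0.
apply/ltW/(le_lt_trans _ (fN l Nl)).
by rewrite ler_wpM2l ?(ltW (f0 _ _))// expr2 addn1 ler_wpM2r// ler_nat.
Qed.

(** * Diagonal operators, and [Dinf] described by coefficients *)

Section FockCoefficients.
Context {R : realType} (F : fockSpace R).
Local Notation C := (complex R).
Local Notation H := (fock_sp F).
Local Notation ip := (fock_ip F).
Local Notation ipE := (@fock_ipE R F).
Local Notation D := (Dinf F).
Local Notation e := (@num_state R F).
Local Notation c u l := (ip u (num_state F l)).
Local Notation e_orth := (@num_state_orth R F).
Local Notation e_dense := (@num_state_dense R F).
Local Notation P n u := (\sum_(l < n) ip u (e l) *: e l).

Lemma num_coef_inj u v : (forall l, c u l = c v l) -> u = v.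
Proof. exact: (coef_inj ipE e_orth e_dense). Qed.

Lemma PilE l u : Pil l u = c u l *: e l.
Proof.
rewrite /Pil !state_num_state !ipZr ipZl e_orth eqxx mulr1 scalerA; congr (_ *: _).
rewrite sqrtC_nat_conj; move: (sqrt_fact_neq0 (R := R) l) (ip u (e l)) => q0 x.
by field.
Qed.

Lemma coef_QL L u m : c (QL L u) m = if (m <= L)%N then c u m else 0.
Proof.
rewrite /QL; under eq_bigr do rewrite PilE.
exact: (coef_sum e_orth (fun l => c u l)).
Qed.

Lemma Dinf_QL L u : D (QL L u).
Proof.
rewrite /QL; under eq_bigr do rewrite PilE.
exact: (Dinf_num_sum F (fun l => c u l)).
Qed.

(* Eigenvalue of [HL L] on the number state [m]. *)
Definition cutoff (L m : nat) : nat := if (m <= L)%N then m else 0%N.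

(** For [m <= L] no cut-off is felt: the product lowers [m] to [m - 1] and raises it back, with a
    square root of [m] each time. *)
Lemma coef_HL L u m : c (HL L u) m = (cutoff L m)%:R * c u m.
Proof.
rewrite /HL /creL /annL/= coef_QL /cutoff; case: ifP => mL; last by rewrite mul0r.
case: m mL => [|m] mL.
  by rewrite mul0r coef_cre0//; exact: Dinf_QL.
rewrite coef_cre; last exact: Dinf_QL.
rewrite !coef_QL (ltnW mL) coef_ann; last exact: Dinf_QL.
by rewrite coef_QL mL mulrA -expr2 sqrtCK.
Qed.

(** Closed form of the exponential: as [HL L] vanishes beyond [L], only finitely many coefficients
    change. *)
Definition evol_sum L t u : H :=
  u + \sum_(l < L.+1) ((phase (l%:R * t) - 1) * c u l) *: e l.

Lemma coef_evol_sum L t u m : c (evol_sum L t u) m = phase ((cutoff L m)%:R * t) * c u m.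
Proof.
rewrite ipDl (coef_sum e_orth (fun l => (phase (l%:R * t) - 1) * c u l)) ltnS /cutoff.
by case: ifP => _; [rewrite mulrBl mul1r addrC subrK|rewrite mul0r phase0 mul1r addr0].
Qed.

(** Coefficientwise the exponential series converges to a phase; having only the eigenvalues [0] to
    [L], [HL L] makes this uniform in the coefficient, hence a limit in norm. *)
Lemma evolE L t u : evol L t u = evol_sum L t u.
Proof.
rewrite /evol /opexp; apply: cvg_lim; first exact: norm_hausdorff.
pose A v : H := ('i * real_complex R t) *: HL L v.
have cA k m : c (iter k A u) m =
    ('i * real_complex R ((cutoff L m)%:R * t)) ^+ k * c u m.
  elim: k => [|k IH]; first by rewrite mul1r.
  rewrite /= ipZl coef_HL IH exprS rmorphM/= rmorph_nat; ring.
apply/cvgrPdist_le => eps eps0.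
have u1 : 0 < `|u| + 1 by rewrite ltr_wpDl.
have eu : 0 < eps / (`|u| + 1) by rewrite divr_gt0.
have : \forall n \near \oo, forall l : 'I_L.+1, `|phase (l%:R * t) -
  \sum_(k < n) (k`!%:R)^-1 * ('i * (real_complex R (l%:R * t))) ^+ k| < eps / (`|u| + 1).
  by apply: filter_forall => l; exact: phase_cvg.
apply: filterS => n ln.
apply: (@le_trans _ _ (eps / (`|u| + 1) * `|u|)); last first.
  by rewrite mulrAC ler_pdivrMr// ler_pM2l// lerDl.
apply: (norm_le_shiftl ipE e_orth e_dense (m := 0%N)) => [|m]; first exact: ltW.
rewrite addn0 ipBl coef_evol_sum /series/= big_mkord ip_suml.
under eq_bigr do rewrite ipZl cA mulrA.
rewrite -mulr_suml -mulrBl normrM ler_wpM2r// ltW//.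
(* Indices above [L] have eigenvalue [0], so they are covered too. *)
have cL : (cutoff L m < L.+1)%N by rewrite /cutoff; case: ifP.
exact: (ln (Ordinal cL)).
Qed.

Lemma coef_evol L t u m : c (evol L t u) m = phase ((cutoff L m)%:R * t) * c u m.
Proof. by rewrite evolE coef_evol_sum. Qed.

Lemma evol_adj L t u v : ip (evol L t u) v = ip u (evol L (- t) v).
Proof.
rewrite !evolE /evol_sum ipDl ipDr ip_suml ip_sumr; congr (_ + _).
apply: eq_bigr => l _; rewrite ipZl ipZr (ipC _ v) rmorphM rmorphB/= rmorph1 conj_phase mulrN opprK.
rewrite conjCK; ring.
Qed.

(** Bounds for all [k] already force decay faster than any power, so no limit is stated. *)
Definition rapidly_decreasing (d : nat -> C) :=
  forall k : nat, exists K, forall l : nat, l%:R ^+ k * `|d l| <= K.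

Lemma rapidly_decreasing_summable d : rapidly_decreasing d ->
  exists2 K, 0 <= K & forall l, `|d l| <= K / (l.+1%:R * l.+2%:R).
Proof.
move=> rd; have [K0 k0] := rd 0%N; have [K1 k1] := rd 1%N; have [K2 k2] := rd 2%N.
(* The multiplicities [3] and [2] come from expanding [(l + 1) * (l + 2)]. *)
have b l : `|d l| * (l.+1%:R * l.+2%:R) <= K2 + K1 *+ 3 + K0 *+ 2.
  have -> : `|d l| * (l.+1%:R * l.+2%:R) =
      l%:R ^+ 2 * `|d l| + (l%:R ^+ 1 * `|d l|) *+ 3 + (l%:R ^+ 0 * `|d l|) *+ 2.
    by rewrite -[l.+2%:R]natr1 -[l.+1%:R]natr1; ring.
  by rewrite !lerD// lerMn2r; apply/orP; right.
exists (K2 + K1 *+ 3 + K0 *+ 2) => [|l]; last by rewrite ler_pdivlMr// mulr_gt0.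
by apply: le_trans (b 0%N); rewrite !mulr_ge0.
Qed.

Lemma rapidly_decreasingM d : rapidly_decreasing d ->
  rapidly_decreasing (fun l => l%:R * d l).
Proof.
move=> rd k; have [K rK] := rd k.+1; exists K => l; apply: le_trans (rK l).
by rewrite normrM normr_nat exprSr mulrA.
Qed.

(* [u] lies in the domain of the adjoint of [nop], tested on its partial sums. *)
Lemma nop_dom_coef u : rapidly_decreasing (fun l => c u l) -> nop_dom F u.
Proof.
move=> /rapidly_decreasingM/rapidly_decreasing_summable[K K0 uK].
(* [w] has the coefficients that [nop u] must have. *)
have [w _ wE] := cvg_sum_orth ipE e_orth K0 uK.
have [_ _ _ /(_ u w)[sa _]] := nop_selfadjoint F; apply sa => v vD.
rewrite ipC [RHS]ipC; congr (Num.conj _).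
(* Both vectors are replaced by partial sums, which lie in [Dinf], where [nop] is symmetric and acts
   coefficientwise. *)
apply: (cvg_ip_eq ipE (proj_cvg ipE e_orth e_dense (u := u))
  (proj_cvg ipE e_orth e_dense (u := w))).
near=> n; rewrite -nop_sym//; last exact/Dinf_nop_dom/(Dinf_num_sum F (fun l => c u l)).
congr (ip _ v); apply: num_coef_inj => m.
rewrite coef_nop; last exact/Dinf_nop_dom/(Dinf_num_sum F (fun l => c u l)).
rewrite (coef_sum e_orth (fun l => c u l)) (coef_sum e_orth (fun l => c w l)) wE.
by case: ifP => //; rewrite mulr0.
Unshelve. all: by end_near. Qed.

(** Forwards, each coefficient of a power of [nop] applied to [u] is bounded by its norm. Backwards,
    rapid decrease puts [u] in the domain of [nop] and passes to [nop u], so induction applies. *)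
Lemma Dinf_coefP u : D u <-> rapidly_decreasing (fun l => c u l).
Proof.
split=> [Du k|ru k _].
  exists `|iter k (nop F) u| => l; apply: le_trans (bessel1 ipE e_orth _ l).
  by rewrite coef_iter_nop// normrM normrX normr_nat.
elim: k u ru => // k IH u ru; have Du := nop_dom_coef ru.
split=> //; apply: IH => j; have [K rK] := rapidly_decreasingM ru j.
by exists K => l; rewrite coef_nop.
Qed.

Lemma Dinf_coef_le u v (K : C) : 0 <= K -> D u ->
  (forall l, `|c v l| <= K * `|c u l|) -> D v.
Proof.
move=> K0 /Dinf_coefP ru vu; apply/Dinf_coefP => k; have [B uB] := ru k.
exists (K * B) => l; apply: le_trans (_ : K * (l%:R ^+ k * `|c u l|) <= _).
  by rewrite mulrCA ler_wpM2l ?exprn_ge0.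
by rewrite ler_wpM2l.
Qed.

Lemma Dinf_evol L t u : D u -> D (evol L t u).
Proof.
by move=> Du; apply: (Dinf_coef_le ler01 Du) => l; rewrite coef_evol normrM normr_phase.
Qed.

(** [rapid_summable] and the boundedness of the coefficients of [u] make the defining series
    converge, so that [limn] is a genuine limit. *)
Lemma coef_fnum f u l : rapid f -> c (fnum f u) l = real_complex R (f l%:R) * c u l.
Proof.
move=> rf; have [K K0 fK] := rapid_summable rf; case: rf => f0 _ _ _.
have [|l'|w] := @cvg_sum_orth _ _ _ ipE _ e_orth
  (fun l => real_complex R (f l%:R) * c u l) (real_complex R K * `|u|).
- by rewrite mulr_ge0// ler0c.
- rewrite normrM mulrAC ler_pM// ?(bessel1 ipE e_orth)//.
  rewrite ger0_norm ?ler0c ?(ltW (f0 _ _))//.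
  have := fK l'; rewrite -lecR => /le_trans; apply.
  by rewrite rmorphM/= fmorphV rmorphM !rmorph_nat.
move=> ws <-; congr (ip _ _); rewrite /fnum; apply: cvg_lim; first exact: norm_hausdorff.
under [X in series X]eq_fun do rewrite PilE scalerA.
exact: ws.
Qed.

Lemma Dinf_fnum f u : rapid f -> D u -> D (fnum f u).
Proof.
move=> rf Du; have [K K0 fK] := rapid_summable rf.
have K0' : 0 <= real_complex R K by rewrite ler0c.
apply: (Dinf_coef_le K0' Du) => l.
rewrite coef_fnum// normrM ler_wpM2r//.
case: rf => f0 _ _ _; rewrite ger0_norm ?ler0c ?(ltW (f0 _ _))// lecR.
apply: le_trans (fK l) _; rewrite ler_pdivrMr ?mulr_gt0//.
by rewrite ler_peMr// -natrM ler1n.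
Qed.

End FockCoefficients.

(** * The algebra [Lplus], a criterion for convergence, ladder weights *)

Section FockOperators.
Context {R : realType} (F : fockSpace R).
Local Notation C := (complex R).
Local Notation H := (fock_sp F).
Local Notation ip := (fock_ip F).
Local Notation ipE := (@fock_ipE R F).
Local Notation D := (Dinf F).
Local Notation c u l := (ip u (num_state F l)).
Local Notation e_orth := (@num_state_orth R F).
Local Notation e_dense := (@num_state_dense R F).
Local Notation Lp := (Lplus ip D).

(** Closability follows from the adjoint: the limit [y] is tested against number states, where the
    adjoint moves the operator off the null sequence. *)
Lemma adj_Lplus (X : H -> H) : linear_on D X -> (forall u, D u -> D (X u)) ->
  (forall v, D v -> exists2 w, D w & adj_graph ip D X v w) -> Lp X.
Proof.
move=> Xlin XD Xadj; split=> // u_ y Du u0 Xy; apply: num_coef_inj => l.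
have [w _ wX] := Xadj _ (Dinf_num_state F l).
rewrite ip0l -(ip0l ip w); apply: (cvg_ip_eq ipE Xy u0).
by near=> n; exact: wX.
Unshelve. all: by end_near. Qed.

Lemma Lplus_id : Lp id.
Proof. by apply: adj_Lplus => // v Dv; exists v. Qed.

Lemma Lplus_comp (X Y : H -> H) : Lp X -> Lp Y -> Lp (X \o Y).
Proof.
move=> [Xl _ XD Xa] [Yl _ YD Ya]; apply: adj_Lplus => [a u v Du Dv|u Du|v Dv] /=.
- by rewrite Yl// Xl//; exact: YD.
- exact/XD/YD.
- have [w Dw wX] := Xa _ Dv; have [z Dz zY] := Ya _ Dw; exists z => // u Du /=.
  by rewrite wX ?zY//; exact: YD.
Qed.

Lemma Lplus_iter n (X : H -> H) : Lp X -> Lp (iter n X).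
Proof.
move=> LX; elim: n => [|n IH]; first exact: Lplus_id.
exact: (Lplus_comp LX IH).
Qed.

Lemma Lplus_scale a (X : H -> H) : Lp X -> Lp (fun u => a *: X u).
Proof.
move=> [Xl _ XD Xa]; apply: adj_Lplus => [b u v Du Dv|u Du|v Dv].
- by rewrite Xl// scalerDr !scalerA mulrC.
- by apply: (lin_subspaceZ (Dinf_lin F)); exact: XD.
- have [w Dw wX] := Xa _ Dv; exists (Num.conj a *: w).
    exact: (lin_subspaceZ (Dinf_lin F)).
  by move=> u Du; rewrite ipZl ipZr conjCK wX.
Qed.

Lemma Lplus_evol L t : Lp (evol L t).
Proof.
apply: adj_Lplus => [a u v _ _|u|v Dv]; last 2 first.
- exact: Dinf_evol.
- by exists (evol L (- t) v) => [|u _]; [exact: Dinf_evol|exact: evol_adj].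
apply: num_coef_inj => l; rewrite ipDl ipZl !coef_evol ipDl ipZl; ring.
Qed.

Lemma Lplus_alpha L t (X : H -> H) : Lp X -> Lp (alpha L t X).
Proof.
move=> LX; apply: Lplus_comp; last exact: Lplus_evol.
by apply: Lplus_comp => //; exact: Lplus_evol.
Qed.

Lemma Dinf_Lplus (X : H -> H) u : Lp X -> D u -> D (X u).
Proof. by case=> _ _ + _; apply. Qed.

Lemma opnorm_le (X : H -> H) (K : R) : 0 <= K ->
  (forall u, D u -> `|X u| <= real_complex R K * `|u|) -> (opnorm D X <= K%:E)%E.
Proof.
move=> K0 XK; apply: ge_ereal_sup => _ [u [Du u1] <-]; rewrite lee_fin.
have : `|X u| <= real_complex R K.
  by apply: le_trans (XK u Du) _; rewrite ler_piMr// ler0c.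
by rewrite lecE => /andP[].
Qed.

(** A neighbourhood involves finitely many seminorms, so each can be treated alone; halving [eps]
    restores the strict inequality. *)
Lemma tau_cvgI (X_ : nat -> H -> H) (X : H -> H) :
  (forall L, Lp (X_ L)) -> Lp X ->
  (forall f k (eps : R), rapid f -> 0 < eps ->
    \forall L \near \oo, (seminorm f k (X_ L \- X)%R <= eps%:E)%E) ->
  tau_cvg X_ X.
Proof.
move=> LX_ LX sX; split=> // U [m [f [k [eps [eps0 rf sub]]]]].
have eps2 : 0 < eps / 2 by rewrite divr_gt0.
have : \forall L \near \oo, forall j : 'I_m,
    (seminorm (f j) (k j) (X_ L \- X)%R <= (eps / 2)%:E)%E.
  by apply: filter_forall => j; exact: sX.
apply: filterS => L sL; apply: sub; split=> // j; apply: le_lt_trans (sL j) _.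
by rewrite lte_fin ltr_pdivrMr// ltr_pMr// ltr1n.
Qed.

(** The square root of [(l + n)! / l!], the matrix element of an [n]-fold ladder step between [l]
    and [l + n]. *)
Definition ladder_weight (l n : nat) : C := \prod_(l <= j < l + n) sqrtC j.+1%:R.

Lemma coef_iter_ann n u l : D u ->
  c (iter n (ann F) u) l = ladder_weight l n * c u (l + n)%N.
Proof.
move=> Du; elim: n l => [|n IH] l.
  by rewrite /ladder_weight addn0 big_geq ?mul1r.
rewrite iterS coef_ann; last exact: Dinf_Lplus (Lplus_iter n (ann_Lplus F)) Du.
by rewrite IH /ladder_weight addnS [in RHS]big_ltn ?ltnS ?leq_addr// mulrA addSn.
Qed.

Lemma coef_iter_cre n u l : D u ->
  c (iter n (cre F) u) (l + n)%N = ladder_weight l n * c u l.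
Proof.
move=> Du; elim: n => [|n IH].
  by rewrite /ladder_weight addn0 big_geq ?mul1r.
rewrite iterS addnS coef_cre; last exact: Dinf_Lplus (Lplus_iter n (cre_Lplus F)) Du.
by rewrite IH /ladder_weight addnS big_nat_recr ?leq_addr//= mulrA [_ * sqrtC _]mulrC.
Qed.

Lemma coef_iter_cre_lt n u l : D u -> (l < n)%N -> c (iter n (cre F) u) l = 0.
Proof.
move=> Du; elim: n l => // n IH [|l] ln;
  have DX := Dinf_Lplus (Lplus_iter n (cre_Lplus F)) Du.
  by rewrite iterS coef_cre0.
by rewrite iterS coef_cre// IH ?mulr0.
Qed.

(** Each of the [n] factors is at most its own square; a polynomial bound is all that [f] needs to
    absorb. *)
Lemma ladder_weight_le l n : `|ladder_weight l n| <= (l + n).+1%:R ^+ n.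
Proof.
elim: n => [|n IH]; first by rewrite /ladder_weight addn0 big_geq ?normr1.
rewrite /ladder_weight addnS big_nat_recr ?leq_addr//= normrM exprSr.
rewrite ler_pM//.
  by apply: le_trans IH _; rewrite lerXn2r ?nnegrE// ler_nat.
rewrite ger0_norm ?sqrtC_ge0//.
apply: (@le_trans _ _ ((l + n).+1%:R)); last by rewrite ler_nat.
rewrite -{2}[_.+1%:R]sqrtCK expr2 ler_peMr ?sqrtC_ge0//.
by rewrite -[leLHS]sqrtC1 ler_sqrtC ?nnegrE// ler1n.
Qed.

(** * Seminorms of weighted shifts supported beyond the cut-off *)

Section ShiftEstimate.
Variables (n L : nat) (Y : H -> H) (g : nat -> C).
Hypothesis YD : forall u, D u -> D (Y u).
Hypothesis g_small : forall l, (l + n <= L)%N -> g l = 0.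
Hypothesis g_le : forall l, `|g l| <= 2 * (l + n).+1%:R ^+ n.
Variables (f : R -> R) (k : nat) (eps : R).
Hypotheses (rf : rapid f) (eps0 : 0 < eps).

(** [x l] is the level at which [f(N)] acts, [l] or [l + n]; the power [n + k] absorbs the bound on
    [g] and [N^k], and the halving absorbs the factor [2] in that bound. *)
Definition tail_small (x : nat -> nat) := forall l, (L < l + n)%N ->
  f (x l)%:R * (l + n).+1%:R ^+ (n + k) <= eps / 2.

(** Serves all four products in the two estimates below; [m] is the level at which [N^k] acts, [l]
    or [l + n]. *)
Lemma shift_factor_le x l m : tail_small x -> (m <= (l + n).+1)%N ->
  `|real_complex R (f (x l)%:R) * g l * m%:R ^+ k| <= real_complex R eps.
Proof.
move=> fx ml; have [lL|Ll] := leqP (l + n) L.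
  by rewrite g_small// mulr0 mul0r normr0 ler0c ltW.
have f0 : 0 <= f (x l)%:R by case: rf => + _ _ _; move/(_ (x l)%:R (ler0n _ _))/ltW.
have fc0 : 0 <= real_complex R (f (x l)%:R) by rewrite ler0c.
rewrite !normrM normrX normr_nat (ger0_norm fc0).
apply: (@le_trans _ _ (real_complex R (f (x l)%:R) * (2 * (l + n).+1%:R ^+ n) *
    (l + n).+1%:R ^+ k)).
  apply: ler_pM; [exact: mulr_ge0|exact: exprn_ge0| |].
    exact: ler_wpM2l.
  by rewrite lerXn2r ?nnegrE// ler_nat.
have := fx l Ll; rewrite ler_pdivlMr// -lecR => /(le_trans _); apply.
rewrite !rmorphM/= rmorphXn/= !rmorph_nat exprD.
rewrite le_eqVlt; apply/orP; left; apply/eqP; ring.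
Qed.

Hypotheses (small_id : tail_small id) (small_addn : tail_small (addn^~ n)).

(** With [f(N)] on the left, it acts at level [l] and [N^k] at [l + n]; with [f(N)] on the right,
    the levels are exchanged. *)
Lemma seminorm_shiftl :
  (forall u l, D u -> c (Y u) l = g l * c u (l + n)%N) ->
  (seminorm f k Y <= eps%:E)%E.
Proof.
move=> YE; have eps0' : 0 <= real_complex R eps by rewrite ler0c ltW.
rewrite /seminorm ge_max; apply/andP; split; apply: (opnorm_le (ltW eps0)) => u Du;
  apply: (norm_le_shiftl ipE e_orth e_dense (m := n)) => // l /=.
- rewrite coef_fnum// YE; last exact: Dinf_iter_nop.
  rewrite coef_iter_nop// mulrA mulrA normrM ler_wpM2r//.
  exact: (shift_factor_le small_id).
- rewrite coef_iter_nop; last exact/YD/Dinf_fnum.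
  rewrite YE ?coef_fnum//; last exact: Dinf_fnum.
  rewrite [X in `|X|](_ : _ =
    real_complex R (f (l + n)%:R) * g l * l%:R ^+ k * c u (l + n)%N); last ring.
  rewrite normrM ler_wpM2r// (shift_factor_le small_addn)//.
  by rewrite (leq_trans (leq_addr n l)).
Qed.

(** For a raising shift the two choices of levels are interchanged. *)
Lemma seminorm_shiftr :
  (forall u l, D u -> c (Y u) (l + n)%N = g l * c u l) ->
  (forall u l, D u -> (l < n)%N -> c (Y u) l = 0) ->
  (seminorm f k Y <= eps%:E)%E.
Proof.
move=> YE Y0; have eps0' : 0 <= real_complex R eps by rewrite ler0c ltW.
rewrite /seminorm ge_max; apply/andP; split; apply: (opnorm_le (ltW eps0)) => u Du;
  apply: (norm_le_shiftr ipE e_orth e_dense (m := n)) => // l /=.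
- by move=> ln; rewrite coef_fnum// Y0 ?mulr0//; exact: Dinf_iter_nop.
- rewrite coef_fnum// YE; last exact: Dinf_iter_nop.
  rewrite coef_iter_nop// mulrA mulrA normrM ler_wpM2r//.
  by rewrite (shift_factor_le small_addn)// (leq_trans (leq_addr n l)).
- by move=> ln; rewrite coef_iter_nop ?Y0 ?mulr0//; [exact: Dinf_fnum|exact/YD/Dinf_fnum].
- rewrite coef_iter_nop; last exact/YD/Dinf_fnum.
  rewrite YE ?coef_fnum//; last exact: Dinf_fnum.
  rewrite [X in `|X|](_ : _ =
    real_complex R (f l%:R) * g l * (l + n)%:R ^+ k * c u l); last ring.
  by rewrite normrM ler_wpM2r// (shift_factor_le small_id).
Qed.

End ShiftEstimate.

Lemma tail_small_near n f k eps : rapid f -> 0 < eps ->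
  \forall L \near \oo, tail_small n L f k eps id /\ tail_small n L f k eps (addn^~ n).
Proof.
move=> rf eps0; have eps2 : 0 < eps / 2 by rewrite divr_gt0.
have [N fN] := rapid_tail (n + k) n rf eps2.
have [M fM] := rapid_tail (n + k) 0 rf eps2.
(* From here on [L < l + n] forces [l] beyond both [N] and [M]. *)
exists (N + M + n)%N => // L /= NL; split=> l Ll; apply/ltW.
  by apply: fN; lia.
by have := fM (l + n)%N; rewrite addn0; apply; lia.
Qed.

(** * Convergence of the evolved powers *)

Definition phase_defect (x y z : R) : C := phase x * phase y - phase z.

Lemma phase_defect_le x y z : `|phase_defect x y z| <= 2.
Proof.
by rewrite (le_trans (ler_normB _ _))// normrM !normr_phase mul1r.
Qed.

Lemma tau_cvg_ann t n : tau_cvg (fun L => alpha L t (iter n (ann F)))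
  (fun u => phase (- (n%:R * t)) *: iter n (ann F) u).
Proof.
have La := Lplus_iter n (ann_Lplus F).
apply: tau_cvgI => [L||f k eps rf eps0].
- exact: Lplus_alpha.
- exact: Lplus_scale.
have := tail_small_near n k rf eps0; apply: filterS => L [s1 s2].
(* Matrix element from level [l + n] to [l]: the left evolution acts at [l], the right one at
   [l + n], and the last phase is that of the limit. *)
pose p l :=
  phase_defect ((cutoff L l)%:R * t) ((cutoff L (l + n))%:R * - t) (- (n%:R * t)).
apply: (seminorm_shiftl (n := n) (L := L) (g := fun l => p l * ladder_weight l n)) => //.
- move=> u Du; apply: (lin_subspaceB (Dinf_lin F)).
    exact: Dinf_Lplus (Lplus_alpha L t La) Du.
  exact: Dinf_Lplus (Lplus_scale _ La) Du.
(* Within the cut-off the phases combine to [l * t - (l + n) * t], so the defect vanishes. *)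
- move=> l lL; rewrite /p /phase_defect -phaseD /cutoff lL (leq_trans (leq_addr n l) lL).
  by rewrite (_ : _ + _ * - t = - (n%:R * t)) ?subrr ?mul0r// natrD; ring.
- by move=> l; rewrite normrM ler_pM// ?phase_defect_le ?ladder_weight_le.
- move=> u l Du; rewrite ipBl ipZl coef_evol !coef_iter_ann//; last exact: Dinf_evol.
  by rewrite coef_evol /p /phase_defect; ring.
Qed.

Lemma tau_cvg_cre t n : tau_cvg (fun L => alpha L t (iter n (cre F)))
  (fun u => phase (n%:R * t) *: iter n (cre F) u).
Proof.
have La := Lplus_iter n (cre_Lplus F).
apply: tau_cvgI => [L||f k eps rf eps0].
- exact: Lplus_alpha.
- exact: Lplus_scale.
have := tail_small_near n k rf eps0; apply: filterS => L [s1 s2].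
(* Here the source is [l] and the target [l + n]. *)
pose p l := phase_defect ((cutoff L (l + n))%:R * t) ((cutoff L l)%:R * - t) (n%:R * t).
apply: (seminorm_shiftr (n := n) (L := L) (g := fun l => p l * ladder_weight l n)) => //.
- move=> u Du; apply: (lin_subspaceB (Dinf_lin F)).
    exact: Dinf_Lplus (Lplus_alpha L t La) Du.
  exact: Dinf_Lplus (Lplus_scale _ La) Du.
- move=> l lL; rewrite /p /phase_defect -phaseD /cutoff lL (leq_trans (leq_addr n l) lL).
  by rewrite (_ : _ + _ * - t = n%:R * t) ?subrr ?mul0r// natrD; ring.
- by move=> l; rewrite normrM ler_pM// ?phase_defect_le ?ladder_weight_le.
- move=> u l Du; rewrite ipBl ipZl coef_evol !coef_iter_cre//; last exact: Dinf_evol.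
  by rewrite coef_evol /p /phase_defect; ring.
- move=> u l Du ln; rewrite ipBl ipZl coef_evol !coef_iter_cre_lt//;
    last exact: Dinf_evol.
  by rewrite !mulr0 subrr.
Qed.

End FockOperators.

Theorem proposition3p1 (R : realType) (F : fockSpace R) (t : R) (n : nat) :
  (exists X : fock_sp F -> fock_sp F,
     tau_cvg (fun L : nat => alpha L t (iter n (ann F))) X) /\
  (exists X : fock_sp F -> fock_sp F,
     tau_cvg (fun L : nat => alpha L t (iter n (cre F))) X).
Proof. by split; eexists; [exact: tau_cvg_ann|exact: tau_cvg_cre]. Qed.
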